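(* (a) There exists a finite convex geometry that is not representable by circles in the plane, i.e. that is not isomorphic to $(\mathscr K,\operatorname{conv}_{\mathscr K})$ for any finite family $\mathscr K$ of closed disks in $\mathbb R^2$. (b) There exists a finite convex geometry that is not representable by ellipses in the plane, i.e. that is not isomorphic to $(\mathscr K,\operatorname{conv}_{\mathscr K})$ for any finite family $\mathscr K$ of (closed, filled) ellipses in $\mathbb R^2$.
   Context: A (finite) convex geometry is a pair $(E,\Phi)$ where $E$ is a finite set and $\Phi:2^E\to 2^E$ is a closure operator with $\Phi(\emptyset)=\emptyset$ satisfying the anti-exchange property: if $A\subseteq E$, $x,y\in E\setminus\Phi(A)$ and $\Phi(A\cup\{x\})=\Phi(A\cup\{y\})$, then $x=y$. The convex sets of the geometry are the sets $X\subseteq E$ with $\Phi(X)=X$. Two convex geometries on $E_1$ and $E_2$ are isomorphic if there is a bijection $\varphi:E_1\to E_2$ such that $X\subseteq E_1$ is convex iff $\varphi(X)$ is convex. For a finite family $\mathscr K$ of compact convex sets in $\mathbb R^2$ and $\mathscr S\subseteq\mathscr K$, $$\operatorname{conv}_{\mathscr K}(\mathscr S)=\Big\{K\in\mathscr K:\ K\subseteq\operatorname{conv}\Big(\bigcup_{S\in\mathscr S}S\Big)\Big\},$$ where $\operatorname{conv}$ is the usual convex hull in $\mathbb R^2$. For any finite family of circles or ellipses, $(\mathscr K,\operatorname{conv}_{\mathscr K})$ is a convex geometry. Circles and ellipses are understood as the compact convex planar regions they bound. *)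

(* Defs.v *)
From HB Require Import structures.
From mathcomp Require Import all_boot all_order all_algebra.
From mathcomp Require Import all_classical all_reals all_analysis.

Set Implicit Arguments.
Unset Strict Implicit.
Unset Printing Implicit Defensive.

Import Order.TTheory GRing.Theory Num.Theory.

Local Open Scope classical_set_scope.
Local Open Scope ring_scope.

Definition closure_operator (E : finType) (Phi : {set E} -> {set E}) : Prop :=
  [/\ forall A : {set E}, A \subset Phi A,
      forall A B : {set E}, A \subset B -> Phi A \subset Phi B &
      forall A : {set E}, Phi (Phi A) = Phi A].

Definition anti_exchange (E : finType) (Phi : {set E} -> {set E}) : Prop :=
  forall (A : {set E}) (x y : E),
    x \notin Phi A -> y \notin Phi A ->
    Phi (x |: A)%SET = Phi (y |: A)%SET -> x = y.

(* [finset.set0] is the empty finite set; plain [set0] is the classical one. *)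
Definition convex_geometry (E : finType) (Phi : {set E} -> {set E}) : Prop :=
  [/\ closure_operator Phi, Phi finset.set0 = finset.set0 & anti_exchange Phi].

Definition geom_convex (E : finType) (Phi : {set E} -> {set E})
  (X : {set E}) : Prop := Phi X = X.

Definition geom_isomorphic (E1 E2 : finType)
    (Phi1 : {set E1} -> {set E1}) (Phi2 : {set E2} -> {set E2}) : Prop :=
  exists2 phi : E1 -> E2, bijective phi &
    forall X : {set E1},
      geom_convex Phi1 X <-> geom_convex Phi2 (phi @: X)%SET.

Definition convex_hull (R : realType) (A : set 'rV[R]_2) : set 'rV[R]_2 :=
  smallest (@convex_set R 'rV[R]_2) A.

(* A finite family of planar sets is given by an injective enumeration
   [K : I -> set 'rV[R]_2] of its members, and a subfamily by a set of
   indices. *)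
Definition conv_family (R : realType) (I : finType) (K : I -> set 'rV[R]_2)
    (S : {set I}) : {set I} :=
  [set i : I | `[< K i `<=` convex_hull (\bigcup_(j in [set` S]) K j) >]]%SET.

Definition representable_by (R : realType) (C : set (set 'rV[R]_2))
    (E : finType) (Phi : {set E} -> {set E}) : Prop :=
  exists (I : finType) (K : I -> set 'rV[R]_2),
    [/\ injective K, forall i, C (K i) & geom_isomorphic Phi (conv_family K)].

(* The library norm on ['rV[R]_2] is the sup norm, so the Euclidean distance
   is written in coordinates. *)
Definition closed_disk (R : realType) (c : 'rV[R]_2) (r : R) : set 'rV[R]_2 :=
  [set p | (p 0 0 - c 0 0) ^+ 2 + (p 0 1 - c 0 1) ^+ 2 <= r ^+ 2].

(* Centre [c]; semi-axis [a] along the unit vector [u], and semi-axis [b]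
   along [u] rotated by a right angle. *)
Definition filled_ellipse (R : realType) (c u : 'rV[R]_2) (a b : R) :
    set 'rV[R]_2 :=
  [set p | let x := p 0 0 - c 0 0 in
           let y := p 0 1 - c 0 1 in
           ((x * u 0 0 + y * u 0 1) / a) ^+ 2
           + ((y * u 0 0 - x * u 0 1) / b) ^+ 2 <= 1].

Definition disks (R : realType) : set (set 'rV[R]_2) :=
  [set D | exists (c : 'rV[R]_2) (r : R), 0 < r /\ D = closed_disk c r].

Definition ellipses (R : realType) : set (set 'rV[R]_2) :=
  [set D | exists (c u : 'rV[R]_2) (a b : R),
     [/\ u 0 0 ^+ 2 + u 0 1 ^+ 2 = 1, 0 < a, 0 < b
       & D = filled_ellipse c u a b]].

(* Main.v *)
(* Disks are ellipses, so a single geometry settles both parts.  Add a point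
   p to an n-element set F and declare convex the sets that contain p or have
   at most two elements.  In a representation, let A(v) be the set of the j in F
   whose region has smaller support function than that of p in direction v.
   Separating a point of the region of p from the hull of the regions of i and j
   shows that every pair {i, j} is contained in some A(v), and A(v) never has
   more than two elements; so all 'C(n, 2) pairs occur among the A(v).  For
   ellipses the difference of two support functions changes sign a bounded
   number of times around the circle, so only O(n) sets A(v) occur. *)
Require Import Defs.
From HB Require Import structures.
From mathcomp Require Import all_boot all_order all_algebra.
From mathcomp Require Import all_classical all_reals all_analysis.
From mathcomp Require Import ring lra zify.

Set Implicit Arguments.
Unset Strict Implicit.
Unset Printing Implicit Defensive.

Import Order.TTheory GRing.Theory Num.Theory.
Import numFieldNormedType.Exports.

Local Open Scope classical_set_scope.
Local Open Scope ring_scope.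

(** * Zeros of a difference of two support functions *)

Lemma poly_root_cover (R : idomainType) (p : {poly R}) : p != 0 ->
  exists2 s : seq R, (size s < size p)%N & forall x, root p x -> x \in s.
Proof.
have [n] := ubnP (size p); elim: n p => // n IHn p /ltnSE le_pn p0.
(* Whether a root is left is decided classically; splitting one off lowers the size by one. *)
have [[x px]|nroot] := pselect (exists x, root p x); last first.
  exists [::] => [|x px]; first by rewrite size_poly_gt0.
  by case: nroot; exists x.
have /factor_theorem[q pE] := px.
have q0 : q != 0 by apply: contraNneq p0 => q0; rewrite pE q0 mul0r.
have sizeE : size p = (size q).+1 by
  rewrite pE size_Mmonic ?monicXsubC// size_XsubC addn2.
have [|s le_s sP] := IHn q _ q0; first by rewrite -sizeE.
exists (x :: s) => [|y]; first by rewrite sizeE.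
by rewrite pE rootM root_XsubC inE orbC => /orP[->//|/sP->]; rewrite orbT.
Qed.

(** The five expressions are the coefficients of [4 (l0 + l1 x)^2 (1 + x^2) - (m0 + m1 x + m2
    x^2)^2]. Since [1 + x^2] is not a constant times a square, this polynomial vanishes only
    trivially. *)
Lemma quartic_coef0 (R : realDomainType) (l0 l1 m0 m1 m2 : R) :
  4 * l0 ^+ 2 - m0 ^+ 2 = 0 -> 8 * l0 * l1 - 2 * m0 * m1 = 0 ->
  4 * (l0 ^+ 2 + l1 ^+ 2) - m1 ^+ 2 - 2 * m0 * m2 = 0 ->
  8 * l0 * l1 - 2 * m1 * m2 = 0 -> 4 * l1 ^+ 2 - m2 ^+ 2 = 0 ->
  [/\ l0 = 0, l1 = 0, m0 = 0, m1 = 0 & m2 = 0].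
Proof.
move=> e0 e1 e2 e3 e4.
(* The coefficients of [x] and [x^3] are subtracted. *)
have : m1 * (m0 - m2) = 0 by lra.
have m1_0 : m1 * (m0 - m2) = 0 -> m1 = 0.
  move/eqP; rewrite mulf_eq0 subr_eq0 => /orP[/eqP//|/eqP m02].
  move: e0 e2 e4; rewrite m02 => e0 e2 e4.
  have /eqP : m1 ^+ 2 = 0 by nra.
  by rewrite sqrf_eq0 => /eqP.
move=> /m1_0 {m1_0}z1; move: e1 e2; rewrite z1 => e1 e2.
have l01 : l0 * l1 = 0 by lra.
have m02 : m0 * m2 = 0.
  have /eqP : (m0 * m2) ^+ 2 = 0.
    have -> : (m0 * m2) ^+ 2 = m0 ^+ 2 * m2 ^+ 2 by ring.
    have -> : m0 ^+ 2 = 4 * l0 ^+ 2 by lra.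
    have -> : m2 ^+ 2 = 4 * l1 ^+ 2 by lra.
    have -> : 4 * l0 ^+ 2 * (4 * l1 ^+ 2) = 16 * (l0 * l1) ^+ 2 by ring.
    by rewrite l01 expr0n mulr0.
  by rewrite sqrf_eq0 => /eqP.
have z (x : R) : x ^+ 2 <= 0 -> x = 0.
  move=> x0; apply/eqP; rewrite -sqrf_eq0; apply/eqP/le_anti.
  by rewrite x0 sqr_ge0.
have h0 := sqr_ge0 l0; have h1 := sqr_ge0 l1.
split => //; apply: z; nra.
Qed.

(* With l := l0 + l1 x and b the sum of squares, f x = 0 forces
   4 l^2 (1 + x^2) = (b - (1 + x^2) - l^2)^2, which has degree at most 4 and is
   trivial only when f is. *)
Lemma sqrt_sub_sign_change (R : realType) (l0 l1 p0 p1 q0 q1 : R)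
    (f := fun x : R => l0 + l1 * x + Num.sqrt (1 + x ^+ 2) -
            Num.sqrt ((p0 + p1 * x) ^+ 2 + (q0 + q1 * x) ^+ 2)) :
  exists2 Z : seq R, (size Z <= 4)%N &
    forall x y, x <= y -> (forall z, z \in Z -> ~~ (x <= z <= y)) ->
      (0 < f x) = (0 < f y).
Proof.
(* [m0 + m1 x + m2 x^2] is [b - (1 + x^2) - l^2], and [P] is [4 l^2 (1 + x^2)] minus its square. *)
pose m0 := p0 ^+ 2 + q0 ^+ 2 - 1 - l0 ^+ 2.
pose m1 := 2 * (p0 * p1 + q0 * q1) - 2 * l0 * l1.
pose m2 := p1 ^+ 2 + q1 ^+ 2 - 1 - l1 ^+ 2.
pose P := Poly [:: 4 * l0 ^+ 2 - m0 ^+ 2; 8 * l0 * l1 - 2 * m0 * m1;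
  4 * (l0 ^+ 2 + l1 ^+ 2) - m1 ^+ 2 - 2 * m0 * m2;
  8 * l0 * l1 - 2 * m1 * m2; 4 * l1 ^+ 2 - m2 ^+ 2].
have a_ge0 x : 0 <= 1 + x ^+ 2 :> R by rewrite addr_ge0// sqr_ge0.
have b_ge0 x : 0 <= (p0 + p1 * x) ^+ 2 + (q0 + q1 * x) ^+ 2.
  by rewrite addr_ge0// sqr_ge0.
(* If [P] vanishes identically, then [l = 0] and the two radicands agree, so [f] is zero everywhere
   and there are no breakpoints. *)
have [P0|P0] := eqVneq P 0.
  have P_0 i : P`_i = 0 by rewrite P0 coef0.
  have := P_0 4; have := P_0 3; have := P_0 2; have := P_0 1; have := P_0 0.
  rewrite !coef_Poly/= => e0 e1 e2 e3 e4.
  have [z0 z1 zm0 zm1 zm2] := quartic_coef0 e0 e1 e2 e3 e4.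
  have f0 x : f x = 0.
    rewrite /f z0 z1 mul0r !add0r; apply/eqP; rewrite subr_eq0; apply/eqP.
    congr Num.sqrt; apply/eqP; rewrite eq_sym -subr_eq0; apply/eqP.
    transitivity (m0 + m1 * x + m2 * x ^+ 2).
      by rewrite /m0 /m1 /m2 z0 z1; ring.
    by rewrite zm0 zm1 zm2; ring.
  by exists [::] => // x y _ _; rewrite !f0.
have [Z sZ ZP] := poly_root_cover P0.
exists Z => [|x y xy noZ].
  by rewrite -ltnS (leq_trans sZ)// (leq_trans (size_Poly _)).
have f0P z : f z = 0 -> root P z.
  rewrite /f => fz0; rewrite rootE horner_Poly/=; apply/eqP.
  have := sqr_sqrtr (a_ge0 z); have := sqr_sqrtr (b_ge0 z).
  move: fz0; set A := Num.sqrt _; set B := Num.sqrt _ => fz0 B2 A2.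
  pose L := l0 + l1 * z.
  have BE : B = L + A by rewrite /L; lra.
  (* From [B = L + A] follows [B ^+ 2 - A ^+ 2 - L ^+ 2 = 2 * L * A]; its square contains only even
     powers of the roots. *)
  transitivity (4 * L ^+ 2 * A ^+ 2 - (B ^+ 2 - A ^+ 2 - L ^+ 2) ^+ 2).
    by rewrite B2 A2 /L /m0 /m1 /m2; ring.
  by rewrite BE; ring.
have cpoly c0 c1 : continuous (fun x : R => c0 + c1 * x).
  move=> z; apply: cvgD; first exact: cvg_cst.
  by apply: cvgM; [exact: cvg_cst|exact: cvg_id].
have csqrt (h : R -> R) : continuous h -> continuous (fun x => Num.sqrt (h x)).
  by move=> ch z; apply: (@continuous_comp _ _ _ h); [exact: ch|exact: sqrt_continuous].
have csqr (h : R -> R) : continuous h -> continuous (fun x => h x ^+ 2).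
  move=> ch z; apply: (@continuous_comp _ _ _ h (fun y => y ^+ 2)).
    exact: ch.
  exact: exprn_continuous.
have cf : continuous f.
  move=> z; apply: cvgB.
    apply: cvgD; first exact: cpoly.
    apply: (csqrt (fun x => 1 + x ^+ 2)) => w.
    by apply: cvgD; [exact: cvg_cst|exact: exprn_continuous].
  apply: (csqrt (fun x => (p0 + p1 * x) ^+ 2 + (q0 + q1 * x) ^+ 2)) => w.
  by apply: cvgD; [exact: (csqr (fun x => p0 + p1 * x))
                  |exact: (csqr (fun x => q0 + q1 * x))].
have noroot z : x <= z <= y -> f z != 0.
  move=> xzy; apply/eqP => /f0P/ZP/noZ.
  by rewrite xzy.
(* Values of opposite signs would force a zero in [[x, y]], against [noroot]. *)
have ivt : ~ (Num.min (f x) (f y) <= 0 <= Num.max (f x) (f y)).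
  move=> h; have cfxy : {within `[x, y], continuous f}.
    exact: continuous_subspaceT.
  have [z zxy fz] := IVT xy cfxy h.
  by move: zxy; rewrite in_itv/= => /noroot; rewrite fz eqxx.
have fx0 : f x != 0 by apply: noroot; rewrite lexx.
have fy0 : f y != 0 by apply: noroot; rewrite lexx xy.
case: (ltgtP 0 (f x)) fx0 => // hx _; case: (ltgtP 0 (f y)) fy0 => // hy _;
  case: ivt; rewrite ge_min le_max (ltW hx) (ltW hy) ?orbT//.
Qed.

(** * Functions that are constant off finitely many breakpoints *)

Lemma ltn_count (T : eqType) (s : seq T) (P Q : pred T) (z : T) :
  subpred P Q -> z \in s -> Q z -> ~~ P z -> (count P s < count Q s)%N.
Proof.
move=> PQ zs Qz nPz.
have : (0 < count (predD Q P) s)%N.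
  by rewrite -has_count; apply/hasP; exists z => //=; rewrite Qz nPz.
have := count_predUI P (predD Q P) s.
have -> : count (predI P (predD Q P)) s = 0%N.
  by rewrite (eq_count (a2 := pred0)) ?count_pred0// => x /=; case: (P x).
have -> : count (predU P (predD Q P)) s = count Q s.
  by apply: eq_count => x /=; have := PQ x; case: (P x) => //= ->.
lia.
Qed.

(** The points of [Z] cut the line into at most [size Z] breakpoints and [size Z + 1] open gaps, and
    [A] is constant on each gap. *)
Lemma finite_values_off_breakpoints (R : realDomainType) (T : eqType) (A : R -> T) (Z : seq R) :
  (forall x y, x <= y -> (forall z, z \in Z -> ~~ (x <= z <= y)) -> A x = A y) ->
  exists2 s : seq T, (size s <= (2 * size Z).+1)%N & forall x, A x \in s.
Proof.
(* [code] separates the points of [Z] and the gaps between them. *)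
move=> AZ; pose code x := (count (< x) Z + count (<= x) Z)%N.
have key x y : code x = code y -> x <= y -> A x = A y.
  move=> cxy; rewrite le_eqVlt => /predU1P[->//|xy].
  have le_cl : (count (< x)%R Z <= count (< y)%R Z)%N.
    by apply: sub_count => z /= zx; exact: lt_trans xy.
  have le_ce : (count (<= x)%R Z <= count (<= y)%R Z)%N.
    by apply: sub_count => z /= zx; exact: le_trans (ltW xy).
  apply: AZ => [|z zZ]; first exact: ltW.
  (* A breakpoint [z] in [[x, y]] would raise one of the two counts: that of [<=] if [z = y], that
     of [<] otherwise. Neither count can drop, so the codes would differ. *)
  apply/negP => /andP[xz]; rewrite le_eqVlt => /predU1P[zy|zy].
    have : (count (<= x)%R Z < count (<= y)%R Z)%N.
      apply: (ltn_count (z := z)) => //=; last by rewrite zy -ltNge.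
        by move=> w /= wx; exact: le_trans (ltW xy).
      by rewrite zy.
    by rewrite /code in cxy; lia.
  have : (count (< x)%R Z < count (< y)%R Z)%N.
    apply: (ltn_count (z := z)) => //=; last by rewrite -leNgt.
    by move=> w /= wx; exact: lt_trans xy.
  by rewrite /code in cxy; lia.
(* [get] evaluates [A] at a representative of the code [k]; for a code without points the default 0
   only adds a harmless entry. *)
pose get k := A (xget 0 [set x | code x = k]).
exists [seq get k | k <- iota 0 (2 * size Z).+1] => [|x].
  by rewrite size_map size_iota.
apply/mapP; exists (code x).
  by rewrite mem_iota add0n/= ltnS mul2n -addnn leq_add// count_size.
rewrite /get; set y := xget _ _.
have yE : code y = code x by apply: (@xgetPex _ _ [set y | code y = code x]); exists x.
by have [/key|/ltW/key] := leP x y; rewrite yE => <-.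
Qed.

(** * Dot product, separation and joins of convex sets in the plane *)

Lemma rV2P (R : realType) (v w : 'rV[R]_2) : v 0 0 = w 0 0 -> v 0 1 = w 0 1 -> v = w.
Proof.
move=> e0 e1; apply/rowP => i; have [->//|i0] := eqVneq i 0.
rewrite (_ : i = 1)//; apply: val_inj => /=; case: i i0 => [[|[|]]] //.
Qed.

Definition dot (R : realType) (v w : 'rV[R]_2) : R :=
  v 0 0 * w 0 0 + v 0 1 * w 0 1.

Lemma dotDr (R : realType) (v x y : 'rV[R]_2) : dot v (x + y) = dot v x + dot v y.
Proof. by rewrite /dot !mxE; ring. Qed.

Lemma dotZr (R : realType) (v x : 'rV[R]_2) a : dot v (a *: x) = a * dot v x.
Proof. by rewrite /dot !mxE; ring. Qed.

Lemma dotBr (R : realType) (v x y : 'rV[R]_2) : dot v (x - y) = dot v x - dot v y.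
Proof. by rewrite /dot !mxE; ring. Qed.

Lemma dotvv_ge0 (R : realType) (v : 'rV[R]_2) : 0 <= dot v v.
Proof. by rewrite /dot -!expr2 addr_ge0// sqr_ge0. Qed.

Lemma dotvv_gt0 (R : realType) (v : 'rV[R]_2) : v != 0 -> 0 < dot v v.
Proof.
move=> v0; rewrite lt_neqAle dotvv_ge0 andbT eq_sym.
apply: contraNneq v0; rewrite /dot -!expr2 => /eqP.
rewrite paddr_eq0 ?sqr_ge0// !sqrf_eq0 => /andP[/eqP v0 /eqP v1].
by apply/eqP/rV2P; rewrite mxE.
Qed.

Lemma dot_continuous (R : realType) (v : 'rV[R]_2) : continuous (dot v).
Proof.
have c i (x : 'rV[R]_2) : (fun w : 'rV[R]_2 => w 0 i) @ x --> x 0 i.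
  exact: coord_continuous.
by move=> x; apply: (cvgD (cvgM (cvg_cst _) (c 0 x)) (cvgM (cvg_cst _) (c 1 x))).
Qed.

Lemma sqr_dist_continuous (R : realType) (z : 'rV[R]_2) :
  continuous (fun x : 'rV[R]_2 => dot (z - x) (z - x)).
Proof.
have c i (x : 'rV[R]_2) : (fun w : 'rV[R]_2 => w 0 i) @ x --> x 0 i.
  exact: coord_continuous.
rewrite (_ : (fun x => _) = fun x : 'rV[R]_2 =>
  (z 0 0 - x 0 0) * (z 0 0 - x 0 0) + (z 0 1 - x 0 1) * (z 0 1 - x 0 1)).
  have cB i (x : 'rV[R]_2) :
      (fun w : 'rV[R]_2 => z 0 i - w 0 i) @ x --> z 0 i - x 0 i.
    exact: (cvgB (cvg_cst _) (c i x)).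
  by move=> x; apply: (cvgD (cvgM (cB 0 x) (cB 0 x)) (cvgM (cB 1 x) (cB 1 x))).
by apply/funext => x; rewrite /dot !mxE.
Qed.

Lemma convex_setP (R : numDomainType) (M : lmodType R) (A : set M) :
  convex_set (A : set (convex_lmodType M)) <->
  forall (t : R) x y, 0 <= t -> t <= 1 -> A x -> A y -> A (t *: x + (1 - t) *: y).
Proof.
split=> [cA t x y t0 t1 Ax Ay|cA x y t].
  have := @cA x y (Itv01 t0 t1); rewrite !inE; exact.
by rewrite !inE; apply: cA.
Qed.

(** [v] leads from the point [y] of [C] nearest to [z] up to [z]. A point [x] of [C] at an acute
    angle to [v] as seen from [y] would allow a move from [y] toward [x] that comes closer to
    [z]. *)
Lemma strict_separation (R : realType) (C : set 'rV[R]_2) (z : 'rV[R]_2) :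
  compact C -> C !=set0 -> convex_set C -> ~ C z ->
  exists2 v, v != 0 & forall x, C x -> dot v x < dot v z.
Proof.
move=> cptC C0 /convex_setP cvxC nCz.
pose d x := dot (z - x) (z - x).
have cd : {within C, continuous d}.
  exact/continuous_subspaceT/sqr_dist_continuous.
have [y + ymin] := compact_EVT_min C0 cptC cd.
rewrite inE => Cy; exists (z - y) => [|x Cx].
  by rewrite subr_eq0; apply: contra_notN nCz => /eqP ->.
have vv : 0 < dot (z - y) (z - y).
  by apply: dotvv_gt0; rewrite subr_eq0; apply: contra_notN nCz => /eqP ->.
suff : dot (z - y) (x - y) <= 0.
  by move: vv; rewrite !dotBr; lra.
set D := dot (z - y) (x - y); rewrite leNgt; apply/negP => D0.
pose W := dot (x - y) (x - y).
have W0 : 0 <= W := dotvv_ge0 _.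
(* The distance is smallest at [D / W]; the denominator [D + W] keeps [t] in [(0, 1]], also when [W]
   is small, and still decreases the distance. *)
pose t := D / (D + W).
have DW : 0 < D + W by lra.
have t0 : 0 < t by rewrite divr_gt0.
have t1 : t <= 1 by rewrite ler_pdivrMr// mul1r; lra.
have tDW : t * (D + W) = D by rewrite /t divfK// gt_eqF.
have := ymin (t *: x + (1 - t) *: y); rewrite inE => /(_ (cvxC _ _ _ (ltW t0) t1 Cx Cy)).
have -> : d (t *: x + (1 - t) *: y) = d y - 2 * t * D + t ^+ 2 * W.
  by rewrite /d /D /W /dot !mxE; ring.
have -> : t ^+ 2 * W = t * (D - t * D) by rewrite -{1}tDW; ring.
have : 0 < t * D by rewrite mulr_gt0.
have : 0 < t ^+ 2 * D by rewrite mulr_gt0// exprn_gt0.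
rewrite (_ : t * (D - t * D) = t * D - t ^+ 2 * D); last by ring.
lra.
Qed.

(** For nonempty convex [A] and [B] this is the hull of their union, in a form that makes
    compactness visible: a continuous image of a product. *)
Definition segments (R : realType) (A B : set 'rV[R]_2) : set 'rV[R]_2 :=
  [set z | exists t x y, [/\ 0 <= t <= 1, A x, B y & z = t *: x + (1 - t) *: y]].

Lemma compact_segments (R : realType) (A B : set 'rV[R]_2) :
  compact A -> compact B -> compact (segments A B).
Proof.
move=> cA cB.
pose f (w : R * ('rV[R]_2 * 'rV[R]_2)) := w.1 *: w.2.1 + (1 - w.1) *: w.2.2.
have -> : segments A B = f @` (`[0, 1] `*` (A `*` B)).
  apply/seteqP; split=> z.
    move=> [t [x [y [t01 Ax By ->]]]]; exists (t, (x, y)) => //.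
  by move=> [[t [x y]] [t01 [Ax By]] <-]; exists t, x, y; split.
have cfst (X Y : topologicalType) : continuous (@fst X Y).
  by move=> [x y]; exact: cvg_fst.
have csnd (X Y : topologicalType) : continuous (@snd X Y).
  by move=> [x y]; exact: cvg_snd.
have cf : continuous f.
  move=> w; have w1 : (fun w : _ * (_ * _) => w.1) @ w --> w.1 := cfst _ _ w.
  apply: cvgD; apply: cvgZ.
  - exact: w1.
  - exact: (continuous_comp (csnd _ _ w) (cfst _ _ w.2)).
  - by apply: cvgB; [exact: cvg_cst|exact: w1].
  - exact: (continuous_comp (csnd _ _ w) (csnd _ _ w.2)).
apply: continuous_compact; first exact: continuous_subspaceT.
by apply: compact_setX; [exact: segment_compact|exact: compact_setX].
Qed.

(** Weights are normalised by [a + b]; if that sum is zero, both weights vanish and any point of [A]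
    serves. *)
Lemma convex_scale2 (R : numFieldType) (M : lmodType R) (A : set M) (a b : R) x y :
  convex_set (A : set (convex_lmodType M)) -> 0 <= a -> 0 <= b -> A x -> A y ->
  exists2 z, A z & a *: x + b *: y = (a + b) *: z.
Proof.
move=> /convex_setP cA a0 b0 Ax Ay.
have [/eqP|ab0] := eqVneq (a + b) 0.
  rewrite paddr_eq0// => /andP[/eqP -> /eqP ->].
  by exists x; rewrite // !scale0r !addr0 scale0r.
have ab : 0 < a + b by rewrite lt_neqAle eq_sym ab0 addr_ge0.
exists ((a / (a + b)) *: x + (1 - a / (a + b)) *: y).
  apply: cA => //; first by rewrite divr_ge0// ltW.
  by rewrite ler_pdivrMr// mul1r lerDl.
rewrite scalerDr !scalerA mulrBr mulr1 mulrC divfK// [a + b]addrC addrK//.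
Qed.

(** A combination of two points regroups into an [A] part and a [B] part, and convexity collapses
    each part to a multiple of one point. *)
Lemma convex_segments (R : realType) (A B : set 'rV[R]_2) :
  convex_set A -> convex_set B -> convex_set (segments A B).
Proof.
move=> cA cB; apply/convex_setP.
move=> s z z' s0 s1 [t [x [y [/andP[t0 t1] Ax By ->]]]].
move=> [t' [x' [y' [/andP[t'0 t'1] Ax' By' ->]]]].
have s'0 : 0 <= 1 - s by rewrite subr_ge0.
have h1 : 0 <= s * t by rewrite mulr_ge0.
have h2 : 0 <= (1 - s) * t' by rewrite mulr_ge0.
have h3 : 0 <= s * (1 - t) by rewrite mulr_ge0// subr_ge0.
have h4 : 0 <= (1 - s) * (1 - t') by rewrite mulr_ge0// subr_ge0.
have [x'' Ax'' xE] := convex_scale2 cA h1 h2 Ax Ax'.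
have [y'' By'' yE] := convex_scale2 cB h3 h4 By By'.
exists (s * t + (1 - s) * t'), x'', y''; split => //.
  by apply/andP; split; nra.
have -> : 1 - (s * t + (1 - s) * t') = s * (1 - t) + (1 - s) * (1 - t') by ring.
by rewrite -xE -yE !scalerDr !scalerA addrACA.
Qed.

(** * Support functions of ellipses, and half-planes containing hulls *)

(* [perp u] completes a unit vector [u] to an orthonormal basis. *)
Definition perp (R : realType) (u : 'rV[R]_2) : 'rV[R]_2 :=
  \row_i (if i == 0 then - u 0 1 else u 0 0).

Lemma perp0 (R : realType) (u : 'rV[R]_2) : perp u 0 0 = - u 0 1.
Proof. by rewrite mxE. Qed.

Lemma perp1 (R : realType) (u : 'rV[R]_2) : perp u 0 1 = u 0 0.
Proof. by rewrite mxE. Qed.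

(** In the frame [u], [perp u] the ellipse is the unit disk stretched by [a] and [b]. So the maximum
    of [dot v] is its value at the centre plus the length of [v] stretched in the same way. *)
Definition ellipse_support (R : realType) (c u : 'rV[R]_2) (a b : R)
    (v : 'rV[R]_2) : R :=
  dot v c + Num.sqrt ((a * dot v u) ^+ 2 + (b * dot v (perp u)) ^+ 2).

Lemma filled_ellipseE (R : realType) (c u : 'rV[R]_2) (a b : R) p :
  filled_ellipse c u a b p =
  ((dot (p - c) u / a) ^+ 2 + (dot (p - c) (perp u) / b) ^+ 2 <= 1) :> Prop.
Proof.
rewrite /filled_ellipse /= /dot !mxE /=; congr (is_true (_ + _ ^+ 2 <= _)).
by congr (_ / _); ring.
Qed.

Lemma dot_basis (R : realType) (u v w : 'rV[R]_2) :
  u 0 0 ^+ 2 + u 0 1 ^+ 2 = 1 ->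
  dot v w = dot v u * dot w u + dot v (perp u) * dot w (perp u).
Proof.
move=> u1; rewrite /dot !perp0 !perp1.
transitivity ((v 0 0 * w 0 0 + v 0 1 * w 0 1) * (u 0 0 ^+ 2 + u 0 1 ^+ 2)).
  by rewrite u1 mulr1.
by ring.
Qed.

Lemma cauchy_schwarz2 (R : rcfType) (p q r s : R) :
  r ^+ 2 + s ^+ 2 <= 1 -> p * r + q * s <= Num.sqrt (p ^+ 2 + q ^+ 2).
Proof.
move=> rs; rewrite (le_trans (ler_norm _))// -sqrtr_sqr ler_wsqrtr//.
(* Lagrange's identity: [(p r + q s)^2 + (p s - q r)^2 = (p^2 + q^2) (r^2 + s^2)]. *)
have := sqr_ge0 (p * s - q * r).
have := sqr_ge0 p; have := sqr_ge0 q; nra.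
Qed.

Lemma ellipse_support_le (R : realType) (c u : 'rV[R]_2) (a b : R) v p :
  u 0 0 ^+ 2 + u 0 1 ^+ 2 = 1 -> 0 < a -> 0 < b ->
  filled_ellipse c u a b p -> dot v p <= ellipse_support c u a b v.
Proof.
move=> u1 a0 b0; rewrite filled_ellipseE => /(cauchy_schwarz2 (a * dot v u)
  (b * dot v (perp u))) h.
rewrite /ellipse_support -lerBlDl; apply: le_trans h.
rewrite -dotBr (dot_basis v (p - c) u1) le_eqVlt; apply/orP; left; apply/eqP.
by field; rewrite !gt_eqF.
Qed.

Lemma ellipse_support_attained (R : realType) (c u : 'rV[R]_2) (a b : R) v :
  u 0 0 ^+ 2 + u 0 1 ^+ 2 = 1 -> 0 < a -> 0 < b ->
  exists2 p, filled_ellipse c u a b p & dot v p = ellipse_support c u a b v.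
Proof.
move=> u1 a0 b0; rewrite /ellipse_support.
set P := a * dot v u; set Q := b * dot v (perp u); set S := Num.sqrt _.
have PQ0 : 0 <= P ^+ 2 + Q ^+ 2 by rewrite addr_ge0// sqr_ge0.
have S2 : S ^+ 2 = P ^+ 2 + Q ^+ 2 := sqr_sqrtr PQ0.
(* The maximiser in unit disk coordinates is [(P, Q)] normalised, or the centre if both vanish. *)
have [r [s [rs1 PQ]]] : exists r s, r ^+ 2 + s ^+ 2 <= 1 /\ P * r + Q * s = S.
  have [S0|S0] := eqVneq S 0.
    by exists 0, 0; rewrite expr0n addr0 ler01 !mulr0 addr0 S0.
  exists (P / S), (Q / S); split.
    by rewrite !expr_div_n -mulrDl -S2 divff// sqrf_eq0.
  transitivity ((P ^+ 2 + Q ^+ 2) / S); first by ring.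
  by rewrite -S2 expr2 mulfK.
exists (c + (a * r) *: u + (b * s) *: perp u); last first.
  by rewrite !dotDr !dotZr -PQ /P /Q; ring.
rewrite filled_ellipseE.
have -> : dot (c + (a * r) *: u + (b * s) *: perp u - c) u = a * r.
  transitivity (a * r * (u 0 0 ^+ 2 + u 0 1 ^+ 2)); last by rewrite u1 mulr1.
  by rewrite /dot !mxE /=; ring.
have -> : dot (c + (a * r) *: u + (b * s) *: perp u - c) (perp u) = b * s.
  transitivity (b * s * (u 0 0 ^+ 2 + u 0 1 ^+ 2)); last by rewrite u1 mulr1.
  by rewrite /dot !mxE /=; ring.
by rewrite ![_ * _ / _]mulrAC !divff ?gt_eqF// !mul1r.
Qed.

Lemma ellipse_supportZ (R : realType) (c u : 'rV[R]_2) (a b k : R) v :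
  0 <= k -> ellipse_support c u a b (k *: v) = k * ellipse_support c u a b v.
Proof.
move=> k0; rewrite /ellipse_support.
have dotZl w : dot (k *: v) w = k * dot v w by rewrite /dot !mxE; ring.
rewrite !dotZl [RHS]mulrDr; congr (_ + _).
rewrite (_ : _ + _ = k ^+ 2 * ((a * dot v u) ^+ 2 + (b * dot v (perp u)) ^+ 2)).
  by rewrite sqrtrM ?sqr_ge0// sqrtr_sqr ger0_norm.
by ring.
Qed.

Lemma convex_ellipse (R : realType) (c u : 'rV[R]_2) (a b : R) :
  convex_set (filled_ellipse c u a b).
Proof.
apply/convex_setP => t x y t0 t1; rewrite !filled_ellipseE.
have dotE w : dot (t *: x + (1 - t) *: y - c) w =
    t * dot (x - c) w + (1 - t) * dot (y - c) w.
  by rewrite /dot !mxE; ring.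
have divE p q k : (t * p + (1 - t) * q) / k = t * (p / k) + (1 - t) * (q / k).
  by ring.
rewrite !dotE !divE; move: (_ / _) (_ / _) (_ / _) (_ / _) => Y' X' Y X xy xy'.
(* This is the convexity defect of the sum of squares between the two points. *)
have h : 0 <= t * (1 - t) * ((X - X') ^+ 2 + (Y - Y') ^+ 2).
  by rewrite !mulr_ge0// ?subr_ge0// addr_ge0// sqr_ge0.
have h1 : t * (X ^+ 2 + Y ^+ 2) <= t by rewrite ler_piMr.
have h2 : (1 - t) * (X' ^+ 2 + Y' ^+ 2) <= 1 - t by rewrite ler_piMr// subr_ge0.
by lra.
Qed.

(** The region is closed as a sublevel set, and its support function in the coordinate directions
    encloses it in a box. *)
Lemma compact_ellipse (R : realType) (c u : 'rV[R]_2) (a b : R) :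
  u 0 0 ^+ 2 + u 0 1 ^+ 2 = 1 -> 0 < a -> 0 < b ->
  compact (filled_ellipse c u a b).
Proof.
move=> u1 a0 b0.
pose h := ellipse_support c u a b; pose e (i : 'I_2) : 'rV[R]_2 := delta_mx 0 i.
have dote i p : dot (e i) p = p 0 i.
  have [->|i1] : i = 0 \/ i = 1.
    by case: i => [[|[|]]] // ?; [left|right]; apply: val_inj.
  - by rewrite /dot !mxE/= mul1r mul0r addr0.
  - by rewrite i1 /dot !mxE/= mul1r mul0r add0r.
have dotN v p : dot (- v) p = - dot v p by rewrite /dot !mxE; ring.
apply: (@subclosed_compact _ _
  [set p : 'rV[R]_2 | forall i, `[- h (- e i), h (e i)]%classic (p 0 i)]).
- pose f (p : 'rV[R]_2) := (dot u p / a - dot u c / a) ^+ 2 +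
    (dot (perp u) p / b - dot (perp u) c / b) ^+ 2.
  have -> : filled_ellipse c u a b = f @^-1` [set x | x <= 1].
    apply/funext => p; rewrite filled_ellipseE /f /=.
    by rewrite /dot !mxE; congr (is_true (_ ^+ 2 + _ ^+ 2 <= _)); ring.
  apply: preimage_closed; last exact: closed_le.
  have cs v k l : continuous (fun p : 'rV[R]_2 => (dot v p / k - l) ^+ 2).
    move=> p; have cp : (fun p : 'rV[R]_2 => dot v p / k - l) @ p --> dot v p / k - l.
      exact: (cvgB (cvgM (@dot_continuous R v p) (cvg_cst _)) (cvg_cst _)).
    exact: (continuous_comp cp (@exprn_continuous R 2 _)).
  by move=> p _; exact: (cvgD (cs _ _ _ p) (cs _ _ _ p)).
- by apply: (@rV_compact R 2 (fun i => `[- h (- e i), h (e i)]%classic)) => i; exact: segment_compact.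
- move=> p Kp i; rewrite /= in_itv/=.
  have := ellipse_support_le (e i) u1 a0 b0 Kp.
  have := ellipse_support_le (- e i) u1 a0 b0 Kp.
  by rewrite dotN dote lerNl => -> ->.
Qed.

Lemma segments_sub_hull (R : realType) (A B W : set 'rV[R]_2) :
  A `<=` W -> B `<=` W -> segments A B `<=` convex_hull W.
Proof.
move=> AW BW z [t [x [y [/andP[t0 t1] Ax By ->]]]] C [/= /convex_setP cC WC].
by apply: cC => //; apply: WC; [exact: AW|exact: BW].
Qed.

Lemma hull_halfplane (R : realType) (W : set 'rV[R]_2) v (h : R) :
  (forall x, W x -> dot v x < h) -> forall x, convex_hull W x -> dot v x < h.
Proof.
move=> Wh; apply: (@smallest_sub _ _ _ [set x | dot v x < h]) => //.
apply/convex_setP => t x y t0 t1 /= xh yh; rewrite dotDr !dotZr.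
have [->|tn0] := eqVneq t 0; first by lra.
have tgt0 : 0 < t by rewrite lt_neqAle eq_sym tn0.
have h1 : t * dot v x < t * h by rewrite ltr_pM2l.
have h2 : (1 - t) * dot v y <= (1 - t) * h by rewrite ler_wpM2l ?subr_ge0// ltW.
by lra.
Qed.

(** * Counting the sets A(v) over all directions *)

Section Patterns.
Variables (R : realType) (n : nat).
Variables (c0 u0 : 'rV[R]_2) (a0 b0 : R).
Variables (c u : 'I_n -> 'rV[R]_2) (a b : 'I_n -> R).
Hypotheses (u01 : u0 0 0 ^+ 2 + u0 0 1 ^+ 2 = 1) (a0_gt0 : 0 < a0)
  (b0_gt0 : 0 < b0).

(** This is A(v), with the ellipse [c0, u0, a0, b0] as the region of p. *)
Let pattern (v : 'rV[R]_2) : {set 'I_n} :=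
  [set j | ellipse_support (c j) (u j) (a j) (b j) v <
           ellipse_support c0 u0 a0 b0 v]%SET.

(* Up to a positive factor, every nonzero direction is [chart 1 x],
   [chart (-1) x] or [+- perp u0]; the charts are scaled to turn the square root
   in the support function of the ellipse [c0, u0, a0, b0] into
   [sqrt (1 + x^2)]. *)
Let chart (sgn x : R) : 'rV[R]_2 :=
  sgn *: (a0^-1 *: u0 + (x / b0) *: perp u0).

Lemma patternZ k v : 0 < k -> pattern (k *: v) = pattern v.
Proof.
move=> k0; apply/setP => j; rewrite !inE !ellipse_supportZ ?(ltW k0)//.
by rewrite ltr_pM2l.
Qed.

Lemma dot_chart sgn x w : dot (chart sgn x) w =
  sgn * dot u0 w / a0 + (sgn * dot (perp u0) w / b0) * x.
Proof. by rewrite /chart /dot !mxE; ring. Qed.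

(** Along a chart each index changes its membership only at its at most 4 breakpoints. The pooled
    list has at most [4 * n] points, hence at most [2 * (4 * n) + 1] patterns. *)
Lemma chart_patterns sgn : sgn ^+ 2 = 1 ->
  exists2 s : seq {set 'I_n}, (size s <= (8 * n).+1)%N &
    forall x, pattern (chart sgn x) \in s.
Proof.
move=> sgn1.
have uu : dot u0 u0 = 1 by rewrite -u01 /dot; ring.
have ru : dot (perp u0) u0 = 0 by rewrite /dot perp0 perp1; ring.
have ur : dot u0 (perp u0) = 0 by rewrite /dot perp0 perp1; ring.
have rr : dot (perp u0) (perp u0) = 1 by rewrite -u01 /dot perp0 perp1; ring.
have a0n : a0 != 0 by rewrite gt_eqF.
have b0n : b0 != 0 by rewrite gt_eqF.
pose p0 j := a j * (sgn * dot u0 (u j) / a0).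
pose p1 j := a j * (sgn * dot (perp u0) (u j) / b0).
pose q0 j := b j * (sgn * dot u0 (perp (u j)) / a0).
pose q1 j := b j * (sgn * dot (perp u0) (perp (u j)) / b0).
pose l0 j := sgn * dot u0 (c0 - c j) / a0.
pose l1 j := sgn * dot (perp u0) (c0 - c j) / b0.
have gapE j x : ellipse_support c0 u0 a0 b0 (chart sgn x) -
    ellipse_support (c j) (u j) (a j) (b j) (chart sgn x) =
    l0 j + l1 j * x + Num.sqrt (1 + x ^+ 2) -
    Num.sqrt ((p0 j + p1 j * x) ^+ 2 + (q0 j + q1 j * x) ^+ 2).
  rewrite /ellipse_support !dot_chart.
  have -> : (a0 * (sgn * dot u0 u0 / a0 + sgn * dot (perp u0) u0 / b0 * x)) ^+ 2 +
     (b0 * (sgn * dot u0 (perp u0) / a0 + sgn * dot (perp u0) (perp u0) / b0 * x)) ^+ 2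
     = 1 + x ^+ 2.
    rewrite uu ru ur rr.
    transitivity (sgn ^+ 2 * (1 + x ^+ 2)); last by rewrite sgn1 mul1r.
    by field; rewrite ?a0n ?b0n.
  rewrite [a j * (_ + _)](_ : _ = p0 j + p1 j * x); last by rewrite /p0 /p1; ring.
  rewrite [b j * (_ + _)](_ : _ = q0 j + q1 j * x); last by rewrite /q0 /q1; ring.
  by rewrite /l0 /l1 !dotBr; ring.
have /choice[Z ZP] : forall j, exists Zj : seq R, (size Zj <= 4)%N /\
    forall x y, x <= y -> (forall z, z \in Zj -> ~~ (x <= z <= y)) ->
      (j \in pattern (chart sgn x)) = (j \in pattern (chart sgn y)).
  move=> j.
  have [Zj szZ ZP] :=
    sqrt_sub_sign_change (l0 j) (l1 j) (p0 j) (p1 j) (q0 j) (q1 j).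
  exists Zj; split=> // x y xy /(ZP _ _ xy).
  by rewrite -!gapE !subr_gt0 !inE.
have [|s ss sP] := @finite_values_off_breakpoints R _ (fun x => pattern (chart sgn x))
    (flatten [seq Z j | j <- enum 'I_n]).
  move=> x y xy noZ; apply/setP => j; apply: (ZP j).2 => // z zZ.
  by apply: noZ; apply/flatten_mapP; exists j; rewrite ?mem_enum.
exists s => //; apply: (leq_trans ss); rewrite ltnS.
rewrite size_flatten /shape -map_comp sumnE big_map big_enum/=.
rewrite (_ : 8 * n = 2 * \sum_(j in 'I_n) 4)%N.
  by rewrite leq_mul2l; apply: leq_sum => j _; exact: (ZP j).1.
by rewrite sum_nat_const card_ord; lia.
Qed.

(** Two charts with [8 * n + 1] patterns each, and the two directions that they miss. *)
Lemma direction_patterns :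
  exists2 s : seq {set 'I_n}, (size s <= 16 * n + 4)%N &
    forall v, v != 0 -> pattern v \in s.
Proof.
have [s1 sz1 s1P] := chart_patterns (expr1n R 2).
have [s2 sz2 s2P] := chart_patterns (etrans (sqrrN 1) (expr1n R 2)).
exists (pattern (perp u0) :: pattern (- perp u0) :: s1 ++ s2) => [|v v0].
  rewrite /= size_cat; lia.
have a0n : a0 != 0 by rewrite gt_eqF.
have b0n : b0 != 0 by rewrite gt_eqF.
(* The sign of [al] selects the chart and [be / al] is the parameter on it; [al = 0] leaves the
   multiples of [perp u0]. *)
pose al := a0 * dot v u0; pose be := b0 * dot v (perp u0).
have vE : v = (al / a0) *: u0 + (be / b0) *: perp u0.
  apply: rV2P; rewrite /al /be !mxE/= /dot perp0 perp1.
    transitivity (v 0 0 * (u0 0 0 ^+ 2 + u0 0 1 ^+ 2)).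
      by rewrite u01 mulr1.
    by field; rewrite ?a0n ?b0n.
  transitivity (v 0 1 * (u0 0 0 ^+ 2 + u0 0 1 ^+ 2)).
    by rewrite u01 mulr1.
  by field; rewrite ?a0n ?b0n.
rewrite !in_cons mem_cat.
have [al0|al0|al0] := ltgtP al 0.
- have aln : al != 0 by rewrite lt_eqF.
  have -> : v = (- al) *: chart (-1) (be / al).
    rewrite vE /chart scalerDr !scalerA scalerDr !scalerA.
    by congr (_ *: _ + _ *: _); field; rewrite ?aln ?a0n ?b0n.
  by rewrite patternZ ?oppr_gt0// s2P !orbT.
- have aln : al != 0 by rewrite gt_eqF.
  have -> : v = al *: chart 1 (be / al).
    rewrite vE /chart scalerDr !scalerA scalerDr !scalerA.
    by congr (_ *: _ + _ *: _); field; rewrite ?aln ?a0n ?b0n.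
  by rewrite patternZ// s1P !orbT.
rewrite al0 mul0r scale0r add0r in vE.
have [be0|be0|be0] := ltgtP be 0.
- rewrite vE (_ : (be / b0) *: perp u0 = (- be / b0) *: - perp u0).
    by rewrite patternZ ?eqxx ?orbT// divr_gt0 ?oppr_gt0.
  by rewrite scalerN mulNr scaleNr opprK.
- by rewrite vE patternZ ?eqxx// divr_gt0.
by move: v0; rewrite vE be0 mul0r scale0r eqxx.
Qed.

End Patterns.

(** * The convex geometry *)

Definition pair_closure (n : nat) (X : {set option 'I_n}) : {set option 'I_n} :=
  if (#|X| <= 2)%N then X else (None |: X)%SET.

Lemma sub_pair_closure n (X : {set option 'I_n}) : X \subset pair_closure X.
Proof. by rewrite /pair_closure; case: ifP => // _; exact: finset.subsetUr. Qed.

(** [None] is the added point p, the only element that closing can add. In the anti-exchange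
    property each of [x] and [y] therefore equals the other or is [None], so they agree. *)
Lemma pair_closure_convex_geometry n : convex_geometry (@pair_closure n).
Proof.
split; first split.
- exact: sub_pair_closure.
- move=> A B AB; rewrite {1}/pair_closure; case: ifPn => [_|A2].
    exact: fintype.subset_trans AB (sub_pair_closure B).
  have B2 : ~~ (#|B| <= 2)%N.
    by apply: contra A2; apply: leq_trans; exact: subset_leq_card.
  by rewrite /pair_closure (negPf B2) finset.setUS.
- move=> A; rewrite {2 3}/pair_closure; case: ifPn => A2.
    by rewrite /pair_closure A2.
  rewrite /pair_closure finset.setUA finset.setUid; case: ifP => //.
- by rewrite /pair_closure cards0.
- move=> A x y xA yA eqxy.
  have xPy : x \in pair_closure (y |: A)%SET.
    rewrite -eqxy; apply: (fintype.subsetP (sub_pair_closure _)).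
    exact: finset.setU11.
  have yPx : y \in pair_closure (x |: A)%SET.
    rewrite eqxy; apply: (fintype.subsetP (sub_pair_closure _)).
    exact: finset.setU11.
  have nA z : z \notin pair_closure A -> z \notin A.
    by apply: contra; exact: (fintype.subsetP (sub_pair_closure A)).
  have key z w : z \notin A -> z \in pair_closure (w |: A)%SET ->
      z = w \/ z = None.
    move=> zA; rewrite /pair_closure; case: ifP => _; rewrite !inE (negPf zA) orbF.
      by move/eqP; left.
    by case/orP => /eqP ->; [right|left].
  case: (key _ _ (nA _ xA) xPy) => [//|xN].
  by case: (key _ _ (nA _ yA) yPx) => // ->.
Qed.

(** * Ellipses do not represent the geometry *)

Lemma sub_conv_family (R : realType) (I : finType) (K : I -> set 'rV[R]_2)
  (S : {set I}) : S \subset conv_family K S.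
Proof.
apply/fintype.subsetP => i iS; rewrite inE; apply/asboolP => x Kx C [_ SC].
by apply: SC; exists i.
Qed.

Lemma conv_familyS (R : realType) (I : finType) (K : I -> set 'rV[R]_2)
  (S T : {set I}) : S \subset T -> conv_family K S \subset conv_family K T.
Proof.
move=> /fintype.subsetP ST; apply/fintype.subsetP => i; rewrite !inE => iS.
move=> x /iS xS C [cC TC]; apply: xS; split=> // y [j jS Ky].
by apply: TC; exists j => //; exact: (ST _ jS).
Qed.

Lemma pair_closure_not_ellipses (R : realType) (n : nat) :
  (16 * n + 4 < 'C(n, 2))%N ->
  ~ representable_by (@ellipses R) (@pair_closure n).
Proof.
move=> n_large [I [K [_ Kell [phi bphi iso]]]].
have phi_inj := bij_inj bphi.
have /choice[q qP] : forall i, exists q : 'rV[R]_2 * 'rV[R]_2 * R * R,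
    [/\ q.1.1.2 0 0 ^+ 2 + q.1.1.2 0 1 ^+ 2 = 1, 0 < q.1.2, 0 < q.2 &
        K i = filled_ellipse q.1.1.1 q.1.1.2 q.1.2 q.2].
  move=> i.
  by have [c [u [a [b [u1 a0 b0 KE]]]]] := Kell i; exists (c, u, a, b).
pose h i := ellipse_support (q i).1.1.1 (q i).1.1.2 (q i).1.2 (q i).2.
have hle i v x : K i x -> dot v x <= h i v.
  by have [u1 a0 b0 ->] := qP i; exact: ellipse_support_le.
have hex i v : exists2 x, K i x & dot v x = h i v.
  by have [u1 a0 b0 ->] := qP i; exact: ellipse_support_attained.
have Kcvx i : convex_set (K i).
  by have [_ _ _ ->] := qP i; exact: convex_ellipse.
have Kcpt i : compact (K i).
  by have [u1 a0 b0 ->] := qP i; exact: compact_ellipse.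
pose A v := [set j : 'I_n | h (phi (Some j)) v < h (phi None) v]%SET.
have [s sz sP] : exists2 s : seq {set 'I_n}, (size s <= 16 * n + 4)%N &
    forall v, v != 0 -> A v \in s.
  have [u1 a0 b0 _] := qP (phi None).
  exact: (@direction_patterns R n (q (phi None)).1.1.1 _ _ _
    (fun j => (q (phi (Some j))).1.1.1) (fun j => (q (phi (Some j))).1.1.2)
    (fun j => (q (phi (Some j))).1.2) (fun j => (q (phi (Some j))).2) u1 a0 b0).
have NoneS (X : {set 'I_n}) : None \notin (Some @: X)%SET.
  by apply/imsetP => -[].
have card_A v : (#|A v| <= 2)%N.
  rewrite leqNgt; apply/negP => A3; pose X := (Some @: A v)%SET.
  have cX : (#|X| <= 2)%N = false.
    by apply/negbTE; rewrite -ltnNge card_imset//; exact: Some_inj.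
  have nX : ~ geom_convex (@pair_closure n) X.
    rewrite /geom_convex /pair_closure cX => XE.
    by have := NoneS (A v); rewrite -/X -XE finset.setU11.
  have NX : geom_convex (@pair_closure n) (None |: X)%SET.
    by rewrite /geom_convex /pair_closure finset.setUA finset.setUid; case: ifP.
  (* The isomorphism transfers only convexity: [X] is not convex, so its image gains some [i], and
     the convexity of [None |: X] leaves only [phi None] for it. *)
  have [i iX niX] : exists2 i, i \in conv_family K (phi @: X)%SET &
      i \notin (phi @: X)%SET.
    apply/subsetPn; apply: contra_notN nX => sub.
    by apply/iso; apply/eqP; rewrite finset.eqEsubset sub sub_conv_family.
  have {}niX : i = phi None.
    have : i \in (phi @: (None |: X))%SET.
      have /iso <- := NX; apply: (fintype.subsetP _ _ iX).
      by apply/conv_familyS/imsetS; exact: finset.subsetUr.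
    rewrite imsetU1 in_setU1 (negPf niX) orbF => /eqP //.
  move: iX; rewrite niX inE => /asboolP sub.
  (* The regions indexed by [A v] lie in an open half-plane that excludes the extreme point [x] of
     the region of p, and so does their hull. *)
  have [x Kx xE] := hex (phi None) v.
  have : dot v x < h (phi None) v.
    apply: hull_halfplane (sub _ Kx) => y [i' i'X Ky].
    have /imsetP[_ /imsetP[j jA ->] i'E] : i' \in (phi @: X)%SET := i'X.
    move: jA; rewrite inE; apply: le_lt_trans.
    by apply: hle; rewrite -i'E.
  by rewrite xE ltxx.
have pairs_A (X : {set 'I_n}) : #|X| = 2 -> X \in s.
  move=> X2; have [j [k [_ XE]]] : exists j k, j != k /\ X = [set j; k]%SET.
    by move/eqP: (X2) => /cards2P[j [k]]; exists j, k.
  have SX : geom_convex (@pair_closure n) (Some @: X)%SET.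
    by rewrite /geom_convex /pair_closure (card_imset _ (@Some_inj _)) X2.
  (* A pair is convex, so some point [z] of the region of p lies outside the hull of its two
     regions. *)
  have : phi None \notin conv_family K (phi @: (Some @: X))%SET.
    have /iso -> := SX; apply: contra (NoneS X).
    by move=> /imsetP[w wX /phi_inj ->].
  rewrite inE => /asboolPn/existsNP[z /not_implyP[Kz nz]].
  have KW i : i \in X -> K (phi (Some i)) `<=`
      \bigcup_(j in [set` (phi @: (Some @: X))%SET]) K j.
    by move=> iX x Kx; exists (phi (Some i)) => //=; rewrite !imset_f.
  have jX : j \in X by rewrite XE !inE eqxx.
  have kX : k \in X by rewrite XE !inE eqxx orbT.
  (* The direction 0 only serves to obtain a point of each region. *)
  have [xj Kxj _] := hex (phi (Some j)) 0.
  have [xk Kxk _] := hex (phi (Some k)) 0.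
  have segl x : K (phi (Some j)) x ->
      segments (K (phi (Some j))) (K (phi (Some k))) x.
    move=> Kx; exists 1, x, xk; split; rewrite ?ler01 ?lexx//.
    by rewrite scale1r subrr scale0r addr0.
  have segr x : K (phi (Some k)) x ->
      segments (K (phi (Some j))) (K (phi (Some k))) x.
    move=> Kx; exists 0, xj, x; split; rewrite ?ler01 ?lexx//.
    by rewrite scale0r add0r subr0 scale1r.
  have [||||v v0 vz] := @strict_separation R
      (segments (K (phi (Some j))) (K (phi (Some k)))) z.
  - exact: compact_segments.
  - by exists xj; exact: segl.
  - exact: convex_segments.
  - by move=> /(segments_sub_hull (KW _ jX) (KW _ kX)).
  suff XA : X = A v by rewrite XA; exact: sP.
  (* Inclusion of [X] in [A v] suffices, as [X] has two elements and [A v] at most two. *)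
  apply/eqP; rewrite finset.eqEcard X2 card_A andbT XE.
  apply/fintype.subsetP => i; rewrite !inE => /orP[]/eqP ->.
    have [x Kx <-] := hex (phi (Some j)) v.
    exact: lt_le_trans (vz _ (segl _ Kx)) (hle _ _ _ Kz).
  have [x Kx <-] := hex (phi (Some k)) v.
  exact: lt_le_trans (vz _ (segr _ Kx)) (hle _ _ _ Kz).
have : ('C(n, 2) <= size s)%N.
  rewrite -[n in 'C(n, 2)]card_ord -card_draws cardE uniq_leq_size ?enum_uniq// => X.
  by rewrite mem_enum inE => /eqP/pairs_A.
by rewrite leqNgt (leq_ltn_trans sz).
Qed.

Lemma disks_sub_ellipses (R : realType) : @disks R `<=` @ellipses R.
Proof.
move=> _ [c [r [r0 ->]]].
exists c, (\row_i (i == 0)%:R), r, r; split => //.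
  by rewrite !mxE/= expr1n expr0n addr0.
apply/seteqP; split=> p; rewrite /closed_disk /filled_ellipse /= !mxE/=;
  rewrite !mulr1 !mulr0 addr0 subr0 !expr_div_n -mulrDl ler_pdivrMr ?exprn_gt0//;
  by rewrite mul1r.
Qed.

Theorem corollary4p4 (R : realType) :
  (exists (E : finType) (Phi : {set E} -> {set E}),
     convex_geometry Phi /\ ~ representable_by (@disks R) Phi) /\
  (exists (E : finType) (Phi : {set E} -> {set E}),
     convex_geometry Phi /\ ~ representable_by (@ellipses R) Phi).
Proof.
(* For 40 there are 780 pairs against at most 644 patterns; the inequality holds from 34 on. *)
have cg := pair_closure_convex_geometry 40.
have nell : ~ representable_by (@ellipses R) (@pair_closure 40).
  by apply: pair_closure_not_ellipses; rewrite bin2.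
split; exists (option 'I_40), (@pair_closure 40); split => //.
move=> [I [K [injK Kdisk iso]]]; apply: nell; exists I, K; split => // i.
exact: disks_sub_ellipses.
Qed.
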